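(* Let $f:L\to M$ be a morphism in $\mathrm{Bmod}^{\mathfrak s}$. The sequence $$0\to \mathrm{Ker}(f)\to L\xrightarrow{\ f\ } M\to \mathrm{Coker}(f)\to 0$$ (whose second and fourth arrows are the inclusion and the quotient map) is exact in $\mathrm{Bmod}^{\mathfrak s}$.
   Context: $\mathbb B=\{0,1\}$ is the Boolean semifield ($1+1=1$). A $\mathbb B$-module is a commutative monoid $(M,+,0)$ with $x+x=x$ for all $x$; morphisms are the monoid homomorphisms. $\mathrm{Bmod}^{\mathfrak s}$ is the category of $\mathbb B$-modules endowed with an involution $\sigma$ (an endomorphism with $\sigma^2=\mathrm{id}$), with morphisms the $\mathbb B$-module morphisms commuting with $\sigma$. $M^\sigma$ is the set of fixed points of $\sigma$ in $M$. For $h:L\to M$ in $\mathrm{Bmod}^{\mathfrak s}$, $\mathrm{Ker}(h):=h^{-1}(M^\sigma)$ with the induced involution, and $\mathrm{Coker}(h):=M/\!\sim$ (with the induced addition and involution), where $b\sim b'$ iff $g(b)=g(b')$ for every object $X$ and every morphism $g:M\to X$ of $\mathrm{Bmod}^{\mathfrak s}$ with $\mathrm{Range}(h)\subset \mathrm{Ker}(g)$. The normal image $\overline{\mathrm{Im}}(h)\subset M$ is the kernel of the quotient map $M\to\mathrm{Coker}(h)$. A sequence $A\xrightarrow{u}B\xrightarrow{v}C$ in $\mathrm{Bmod}^{\mathfrak s}$ is exact at $B$ if $\overline{\mathrm{Im}}(u)=\mathrm{Ker}(v)$; a longer sequence is exact if it is exact at each of its intermediate terms. *)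

(* Defs.v *)
From HB Require Import structures.
From mathcomp Require Import all_boot all_order all_algebra.
From mathcomp Require Import boolp classical_sets.

Set Implicit Arguments.
Unset Strict Implicit.
Unset Printing Implicit Defensive.

Import GRing.Theory.

Local Open Scope ring_scope.
Local Open Scope classical_set_scope.
Local Open Scope quotient_scope.

(* The choice structure carried by [nmodType] is no restriction: with the
   axioms of [boolp] every type has one. *)
HB.mixin Record Nmodule_isBmodule M of GRing.Nmodule M := {
  addbb : idempotent_op (@GRing.add M)
}.

#[short(type="bmodType")]
HB.structure Definition Bmodule := {M of Nmodule_isBmodule M & GRing.Nmodule M}.

HB.mixin Record Bmodule_hasInvolution M of Bmodule M := {
  sigma : M -> M;
  sigma_nmod_morphism : nmod_morphism sigma;
  sigmaK : involutive sigma
}.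

#[short(type="bmodsType")]
HB.structure Definition Bmods := {M of Bmodule_hasInvolution M & Bmodule M}.

HB.instance Definition _ (M : bmodsType) :=
  GRing.isNmodMorphism.Build M M (@sigma M) sigma_nmod_morphism.

HB.mixin Record isSigmaMorphism (L M : bmodsType) (h : L -> M) := {
  sigma_morph : {morph h : x / sigma x}
}.

HB.structure Definition BmodsHom (L M : bmodsType) :=
  {h of isSigmaMorphism L M h & @GRing.Additive L M h}.

Notation "{ 'bmods' L -> M }" := (BmodsHom.type L%type M%type)
  (at level 0, L at level 98, M at level 99,
   format "{ 'bmods'  L  ->  M }") : type_scope.

Definition fixed (M : bmodsType) : set M := [set x | sigma x = x].

Definition Ker (L M : bmodsType) (h : {bmods L -> M}) : set L :=
  h @^-1` @fixed M.

Fact unit_addA : associative (fun _ _ : unit => tt).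
Proof. by []. Qed.
Fact unit_addC : commutative (fun _ _ : unit => tt).
Proof. by []. Qed.
Fact unit_add0 : left_id tt (fun _ _ : unit => tt).
Proof. by case. Qed.
HB.instance Definition _ :=
  GRing.isNmodule.Build unit unit_addA unit_addC unit_add0.

Fact unit_addbb : idempotent_op (@GRing.add unit).
Proof. by case. Qed.
HB.instance Definition _ := Nmodule_isBmodule.Build unit unit_addbb.

Fact unit_sigma_nmod_morphism : nmod_morphism (@id unit).
Proof. by []. Qed.
HB.instance Definition _ :=
  Bmodule_hasInvolution.Build unit unit_sigma_nmod_morphism (fun=> erefl).

Fact null_sigma_morph (L M : bmodsType) :
  {morph (\0%R : L -> M) : x / sigma x}.
Proof. by move=> x /=; rewrite raddf0. Qed.
HB.instance Definition _ (L M : bmodsType) :=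
  isSigmaMorphism.Build L M \0%R (@null_sigma_morph L M).

Section KernelObject.
Variables (L M : bmodsType) (h : {bmods L -> M}).

Definition ker_obj : Type := {x : L | x \in Ker h}.

HB.instance Definition _ := SubChoice.on ker_obj.

Fact ker_nmod_closed : GRing.nmod_closed (fun x => x \in Ker h).
Proof.
split; first by rewrite inE /Ker /fixed /= !raddf0.
move=> x y; rewrite !inE /Ker /fixed /= => hx hy.
by rewrite !raddfD /= hx hy.
Qed.

HB.instance Definition _ :=
  GRing.SubChoice_isSubNmodule.Build L _ ker_obj ker_nmod_closed.

Fact ker_addbb : idempotent_op (@GRing.add ker_obj).
Proof. by move=> x; apply: val_inj; rewrite raddfD /= addbb. Qed.

HB.instance Definition _ := Nmodule_isBmodule.Build ker_obj ker_addbb.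

Fact ker_sigma_subproof (x : ker_obj) : sigma (val x) \in Ker h.
Proof.
case: x => x /=; rewrite !inE /Ker /fixed /= => hx.
by rewrite sigma_morph !hx.
Qed.

Definition ker_sigma (x : ker_obj) : ker_obj :=
  Sub (sigma (val x)) (ker_sigma_subproof x).

Fact ker_sigma_nmod_morphism : nmod_morphism ker_sigma.
Proof.
by split=> [|x y]; apply: val_inj; rewrite /= ?raddf0 // !raddfD.
Qed.

Fact ker_sigmaK : involutive ker_sigma.
Proof. by move=> x; apply: val_inj; rewrite /= sigmaK. Qed.

HB.instance Definition _ :=
  Bmodule_hasInvolution.Build ker_obj ker_sigma_nmod_morphism ker_sigmaK.

Definition ker_incl : ker_obj -> L := val.

HB.instance Definition _ := GRing.Additive.on ker_incl.

Fact ker_incl_sigma : {morph ker_incl : x / sigma x}.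
Proof. by []. Qed.

HB.instance Definition _ :=
  isSigmaMorphism.Build ker_obj L ker_incl ker_incl_sigma.

End KernelObject.

Arguments ker_incl {L M} h x.

Section CokernelObject.
Variables (L M : bmodsType) (h : {bmods L -> M}).

Definition coker_sim (b b' : M) : Prop :=
  forall (X : bmodsType) (g : {bmods M -> X}),
    range h `<=` Ker g -> g b = g b'.

Definition coker_rel : rel M := fun b b' => `[< coker_sim b b' >].

Fact coker_rel_refl : reflexive coker_rel.
Proof. by move=> x; apply/asboolP. Qed.

Fact coker_rel_sym : symmetric coker_rel.
Proof.
by move=> x y; apply/asboolP/asboolP => xy X g gh; rewrite (xy X g).
Qed.

Fact coker_rel_trans : transitive coker_rel.
Proof.
move=> y x z /asboolP xy /asboolP yz; apply/asboolP => X g gh.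
by rewrite (xy X g) // (yz X g).
Qed.

Canonical coker_equiv :=
  EquivRel coker_rel coker_rel_refl coker_rel_sym coker_rel_trans.

Definition coker_obj : Type := {eq_quot coker_equiv}.

HB.instance Definition _ := Choice.on coker_obj.
HB.instance Definition _ := EqQuotient.on coker_obj.

Definition coker_pi : M -> coker_obj := \pi_coker_obj.

Fact coker_piP b b' : coker_pi b = coker_pi b' <-> coker_sim b b'.
Proof. by split=> [/eqmodP/asboolP //|/asboolP bb']; apply/eqmodP. Qed.

Definition coker_zero : coker_obj := coker_pi 0.
Definition coker_add (c d : coker_obj) : coker_obj :=
  coker_pi (repr c + repr d).
Definition coker_sigma (c : coker_obj) : coker_obj :=
  coker_pi (sigma (repr c)).

Fact repr_coker_pi b : coker_sim (repr (coker_pi b)) b.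
Proof. by apply/coker_piP; rewrite /coker_pi reprK. Qed.

Fact coker_pi_surj (c : coker_obj) : exists b, c = coker_pi b.
Proof. by exists (repr c); rewrite /coker_pi reprK. Qed.

Fact coker_addE b b' : coker_add (coker_pi b) (coker_pi b') = coker_pi (b + b').
Proof.
apply/coker_piP => X g gh.
by rewrite !raddfD /= (repr_coker_pi _ gh) (repr_coker_pi _ gh).
Qed.

Fact coker_sigmaE b : coker_sigma (coker_pi b) = coker_pi (sigma b).
Proof.
by apply/coker_piP => X g gh; rewrite !sigma_morph (repr_coker_pi _ gh).
Qed.

Fact coker_addA : associative coker_add.
Proof.
move=> c d e.
have [x ->] := coker_pi_surj c; have [y ->] := coker_pi_surj d.
by have [z ->] := coker_pi_surj e; rewrite !coker_addE addrA.
Qed.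

Fact coker_addC : commutative coker_add.
Proof.
move=> c d; have [x ->] := coker_pi_surj c; have [y ->] := coker_pi_surj d.
by rewrite !coker_addE addrC.
Qed.

Fact coker_add0 : left_id coker_zero coker_add.
Proof. by move=> c; have [x ->] := coker_pi_surj c; rewrite coker_addE add0r. Qed.

HB.instance Definition _ :=
  GRing.isNmodule.Build coker_obj coker_addA coker_addC coker_add0.

Fact coker_addbb : idempotent_op (@GRing.add coker_obj).
Proof.
by move=> c; have [x ->] := coker_pi_surj c; rewrite [LHS]coker_addE addbb.
Qed.

HB.instance Definition _ := Nmodule_isBmodule.Build coker_obj coker_addbb.

Fact coker_sigma_nmod_morphism : nmod_morphism coker_sigma.
Proof.
split=> [|c d]; first by rewrite [LHS]coker_sigmaE raddf0.
have [x ->] := coker_pi_surj c; have [y ->] := coker_pi_surj d.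
by rewrite [_ + _]coker_addE !coker_sigmaE raddfD [RHS]coker_addE.
Qed.

Fact coker_sigmaK : involutive coker_sigma.
Proof.
by move=> c; have [x ->] := coker_pi_surj c; rewrite !coker_sigmaE sigmaK.
Qed.

HB.instance Definition _ :=
  Bmodule_hasInvolution.Build coker_obj coker_sigma_nmod_morphism coker_sigmaK.

Fact coker_pi_nmod_morphism : nmod_morphism coker_pi.
Proof. by split=> [|x y] //; rewrite [RHS]coker_addE. Qed.

HB.instance Definition _ :=
  GRing.isNmodMorphism.Build M coker_obj coker_pi coker_pi_nmod_morphism.

Fact coker_pi_sigma : {morph coker_pi : x / sigma x}.
Proof. by move=> x; rewrite [RHS]coker_sigmaE. Qed.

HB.instance Definition _ :=
  isSigmaMorphism.Build M coker_obj coker_pi coker_pi_sigma.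

End CokernelObject.

Definition normal_image (L M : bmodsType) (h : {bmods L -> M}) : set M :=
  Ker (coker_pi h).

(* Both sides are subobjects of [B] with the structure induced from [B], so
   comparing the underlying subsets is enough. *)
Definition exact_at (A B C : bmodsType)
    (u : {bmods A -> B}) (v : {bmods B -> C}) : Prop :=
  normal_image u = Ker v.

(* Main.v *)
(** An element of the codomain of [h] lies in the normal image of [h] exactly
    when it lies in [Ker g] for every [g] whose kernel contains the range of
    [h]. So each inclusion of a normal image in a kernel follows by choosing
    one [g]: the identity of [Ker f] at [Ker f], and [f] itself at [L]. *)
Require Import Defs.
From HB Require Import structures.
From mathcomp Require Import all_boot all_order all_algebra.
From mathcomp Require Import boolp classical_sets.

Fact idfun_sigma_morph (M : bmodsType) : {morph @idfun M : x / sigma x}.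
Proof. by []. Qed.
HB.instance Definition _ (M : bmodsType) :=
  isSigmaMorphism.Build M M idfun (idfun_sigma_morph M).

(** Membership means that [coker_pi h] identifies [sigma b] with [b], that is, [g (sigma b) = g b]
    for each such [g]; and [g] commutes with [sigma]. *)
Lemma normal_imageP (L M : bmodsType) (h : {bmods L -> M}) (b : M) :
  normal_image h b <->
  forall (X : bmodsType) (g : {bmods M -> X}),
    (range h `<=` Ker g)%classic -> Ker g b.
Proof.
rewrite /normal_image /Ker /fixed /= -sigma_morph coker_piP.
by split=> hb X g /hb; rewrite sigma_morph.
Qed.

Lemma Ker0 (L M : bmodsType) : Ker (\0%R : {bmods L -> M}) = setT.
Proof. by apply/seteqP; split=> // x _; rewrite /Ker /fixed /= GRing.raddf0. Qed.

Theorem proposition1p6 (L M : bmodsType) (f : {bmods L -> M}) :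
  [/\ exact_at (\0%R : {bmods unit -> ker_obj f}) (ker_incl f),
      exact_at (ker_incl f) f,
      exact_at f (coker_pi f)
    & exact_at (coker_pi f) (\0%R : {bmods coker_obj f -> unit})].
Proof.
split.
- apply/seteqP; split=> x; rewrite normal_imageP.
    move=> /(_ _ (idfun : {bmods ker_obj f -> ker_obj f})) x_fixed.
    rewrite /Ker /fixed /= -sigma_morph; congr (ker_incl f _).
    by apply: x_fixed => _ [y _ <-]; rewrite /Ker /fixed /= GRing.raddf0.
  move=> x_fixed X g _; rewrite /Ker /fixed /= -sigma_morph.
  (* The inclusion is injective, so [x] is already fixed in [ker_obj f]. *)
  by congr (g _); apply: val_inj.
- apply/seteqP; split=> x; rewrite normal_imageP.
    by move=> /(_ _ f); apply=> _ [y _ <-]; apply/set_mem/(valP y).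
  (* A point of [Ker f] is in the range of the inclusion. *)
  by move=> fx X g; apply; exists (Sub x (mem_set fx)).
(* Both sides are [Ker (coker_pi f)] by definition. *)
- by [].
- rewrite /exact_at Ker0; apply/seteqP; split=> // c _; rewrite normal_imageP.
  (* Surjectivity of [coker_pi f] puts [c] in its range. *)
  by move=> X g; apply; have [b ->] := coker_pi_surj c; exists b.
Qed.
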